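(* Let $D=\{x^{(1)},\dots,x^{(n)}\}\subset I^d$ be a finite dataset of $n$ points, $y\in I^d$ a query point, and $1\le k\le n$. Let $C_i$ ($1\le i\le M$) be the candidate set of the $i$-th subspace, as defined in the context, and let $$C=C_1\cup C_2\cup\cdots\cup C_M$$ be the final candidate set. Then the $k$ nearest neighbor points of $y$ in $D$ belong to $C$; that is, if $N\subseteq D$ has $k$ elements and $D_f(x,y)\le D_f(x',y)$ for all $x\in N$ and $x'\in D\setminus N$, then $N\subseteq C$.
   Context: Let $I\subseteq\mathbb{R}$ be an open interval and $f:I\to\mathbb{R}$ a differentiable convex function. The same letter $f$ denotes the separable extension to vectors $v=(v_1,\dots,v_m)\in I^m$ (any $m$): $f(v)=\sum_{j=1}^m f(v_j)$; thus $\frac{\partial f(v)}{\partial v_j}=f'(v_j)$. The Bregman distance between $u,v\in I^m$ is $D_f(u,v)=f(u)-f(v)-\langle\nabla f(v),u-v\rangle$. Let $d,M$ be positive integers with $M\le d$. A vector $x\in I^d$ is partitioned into $M$ subvectors of consecutive coordinates, $x_{i\cdot}=(x_{\lceil d/M\rceil(i-1)+1},\dots,x_{\lceil d/M\rceil i})=(x_{i1},\dots,x_{i\lceil d/M\rceil})$, $1\le i\le M$, and $y$ is partitioned in the same manner. If $M$ does not divide $d$, coordinates with index larger than $d$ are simply absent (the corresponding terms are omitted from all sums). For each $i$, the subspace upper bound is $$UB(x_{i\cdot},y_{i\cdot})=\sum_{j} f(x_{ij})-\sum_{j} f(y_{ij})+\sum_{j} y_{ij}f'(y_{ij})+\sqrt{\Big(\sum_{j}x_{ij}^2\Big)\Big(\sum_{j}f'(y_{ij})^2\Big)},$$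 with $j$ ranging over $1,\dots,\lceil d/M\rceil$, and $UB(x,y)=\sum_{i=1}^M UB(x_{i\cdot},y_{i\cdot})$. Searching bounds: let $t\in\{1,\dots,n\}$ be an index such that $UB(x^{(t)},y)$ is the $k$-th smallest among $UB(x^{(1)},y),\dots,UB(x^{(n)},y)$ (counted with multiplicity). The searching bound of the $i$-th subspace is $r_i=UB(x^{(t)}_{i\cdot},y_{i\cdot})$. Candidate sets: $C_i$ is the result of the range query with radius $r_i$ in the $i$-th subspace, $C_i=\{x\in D: D_f(x_{i\cdot},y_{i\cdot})\le r_i\}$. *)

(* Defs.v *)
From mathcomp Require Import all_boot all_order all_algebra.
From mathcomp Require Import finmap.
From mathcomp Require Import all_classical all_reals all_analysis.
Import Order.TTheory GRing.Theory Num.Theory.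
Import numFieldNormedType.Exports.

Set Implicit Arguments.
Unset Strict Implicit.
Unset Printing Implicit Defensive.

Local Open Scope classical_set_scope.
Local Open Scope ring_scope.

(* A function f : I -> R on an open interval I is represented by a total
   function R -> R of which only the restriction to I is constrained; since I
   is open, the derivative at a point of I depends on that restriction only. *)
Definition vec_in (R : realType) (I : set R) (m : nat) (v : 'rV[R]_m) : Prop :=
  forall j, I (v 0 j).

Definition separable_ext (R : realType) (f : R -> R) (m : nat)
    (v : 'rV[R]_m) : R :=
  \sum_(j < m) f (v 0 j).

Definition gradient (R : realType) (m : nat) (F : 'rV[R]_m -> R)
    (v : 'rV[R]_m) : 'rV[R]_m :=
  \row_(j < m) 'D_(delta_mx 0 j) F v.

Definition inner (R : realType) (m : nat) (u v : 'rV[R]_m) : R :=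
  \sum_(j < m) u 0 j * v 0 j.

Definition bregman (R : realType) (f : R -> R) (m : nat) (u v : 'rV[R]_m) : R :=
  separable_ext f u - separable_ext f v
  - inner (gradient (@separable_ext R f m) v) (u - v).

Definition ceil_div (d M : nat) : nat := ((d + M.-1) %/ M)%N.

(* Blocks are numbered from 0, and block i holds the coordinates ceil(d/M) * i
   + j, j < ceil(d/M), that are smaller than d.  The last blocks may thus be
   shorter than ceil(d/M), or even empty (e.g. d = 5, M = 4). *)
Definition block_size (d M i : nat) : nat :=
  minn (ceil_div d M) (d - ceil_div d M * i).

Lemma block_index_lt (d M i : nat) (j : 'I_(block_size d M i)) :
  (ceil_div d M * i + j < d)%N.
Proof.
by have := ltn_ord j; rewrite {2}/block_size leq_min ltn_subRL => /andP[].
Qed.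

Definition subvec (R : realType) (d M : nat) (v : 'rV[R]_d) (i : 'I_M) :
    'rV[R]_(block_size d M i) :=
  \row_(j < block_size d M i) v 0 (Ordinal (block_index_lt j)).

Definition sub_UB (R : realType) (f : R -> R) (m : nat) (u v : 'rV[R]_m) : R :=
  \sum_(j < m) f (u 0 j) - \sum_(j < m) f (v 0 j)
  + \sum_(j < m) v 0 j * derive1 f (v 0 j)
  + Num.sqrt ((\sum_(j < m) u 0 j ^+ 2)
              * (\sum_(j < m) derive1 f (v 0 j) ^+ 2)).

Definition UB (R : realType) (f : R -> R) (d M : nat) (u v : 'rV[R]_d) : R :=
  \sum_(i < M) sub_UB f (subvec u i) (subvec v i).

(* The k-th smallest value, k >= 1, is the entry k.-1 of the sorted sequence of
   all the values a 0, ..., a (n - 1), repetitions included. *)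
Definition is_kth_smallest (R : realType) (n : nat) (a : 'I_n -> R) (k : nat)
    (t : 'I_n) : Prop :=
  a t = nth 0 (sort <=%R (codom a)) k.-1.

Definition candidates (R : realType) (f : R -> R) (d M : nat)
    (D : set 'rV[R]_d) (y : 'rV[R]_d) (r : 'I_M -> R) (i : 'I_M) :
    set 'rV[R]_d :=
  [set z | D z /\ bregman f (subvec z i) (subvec y i) <= r i].

Definition is_knn (R : realType) (f : R -> R) (d : nat) (D : set 'rV[R]_d)
    (y : 'rV[R]_d) (k : nat) (N : {fset 'rV[R]_d}) : Prop :=
  [/\ [set` N] `<=` D, #|` N| = k &
      forall z z', [set` N] z -> (D `\` [set` N]) z' ->
        bregman f z y <= bregman f z' y].

(* Main.v *)
(* Cauchy-Schwarz gives D_f <= UB on every block, hence on the whole space by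
   summing over the blocks.  At least k data points z' satisfy
   D_f(z', y) <= UB(z', y) <= UB(x t, y), so every k-nearest neighbor z
   satisfies D_f(z, y) <= UB(x t, y) as well.  Both sides are sums over the
   blocks, so D_f(z_i, y_i) <= r_i for at least one i. *)
Require Import Defs.
From mathcomp Require Import all_boot all_order all_algebra.
From mathcomp Require Import finmap.
From mathcomp Require Import all_classical all_reals all_analysis.
From mathcomp Require Import zify ring.
Import Order.TTheory GRing.Theory Num.Theory.
Import numFieldNormedType.Exports.

Set Implicit Arguments.
Unset Strict Implicit.
Unset Printing Implicit Defensive.

Local Open Scope classical_set_scope.
Local Open Scope ring_scope.

(** Lagrange's identity: the double sum of the squares [(a i * b j - a j * b i) ^+ 2] is twice the
    gap in the squared Cauchy-Schwarz inequality. *)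
Lemma sum_mul_le_sqrt (R : rcfType) (m : nat) (a b : 'I_m -> R) :
  \sum_j a j * b j <= Num.sqrt ((\sum_j a j ^+ 2) * (\sum_j b j ^+ 2)).
Proof.
have CS : (\sum_j a j * b j) ^+ 2 <= (\sum_j a j ^+ 2) * (\sum_j b j ^+ 2).
  have : 0 <= \sum_i \sum_j (a i * b j - a j * b i) ^+ 2.
    by apply: sumr_ge0 => i _; apply: sumr_ge0 => j _; exact: sqr_ge0.
  rewrite (eq_bigr (fun i => \sum_j (a i ^+ 2 * b j ^+ 2) +
      \sum_j (a j ^+ 2 * b i ^+ 2) - (\sum_j a i * b i * (a j * b j)) *+ 2)).
    2: move=> i _; rewrite -sumrMnl -big_split -sumrB.
    2: by apply: eq_bigr => j _ /=; ring.
  rewrite sumrB big_split /= [X in _ + X - _]exchange_big /= sumrMnl.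
  by rewrite -!big_distrlr /= -expr2 -mulr2n -mulrnBl pmulrn_lge0 // subr_ge0.
by rewrite (le_trans (ler_norm _))// -sqrtr_sqr ler_wsqrtr.
Qed.

(* The two sides are limits of the same difference quotients, so f need not be
   derivable. *)
Lemma gradient_separable_ext (R : realType) (f : R -> R) (m : nat)
    (v : 'rV[R]_m) :
  gradient (@separable_ext R f m) v = \row_j derive1 f (v 0 j).
Proof.
apply/rowP => j; rewrite !mxE /derive /derive1.
set q := (fun _ : R => _); set q' := (fun _ : R => _).
suff -> : q = q' by [].
apply/funext => h; rewrite /q /q' /=; congr (_ *: _).
rewrite /separable_ext -!sumrB (bigD1 j)//= big1 => [|i ij].
  by rewrite addr0 !mxE !eqxx mulr1.
by rewrite !mxE (negPf ij) andbF mulr0 add0r subrr.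
Qed.

Lemma bregmanE (R : realType) (f : R -> R) (m : nat) (u v : 'rV[R]_m) :
  bregman f u v =
  \sum_j (f (u 0 j) - f (v 0 j) - derive1 f (v 0 j) * (u 0 j - v 0 j)).
Proof.
rewrite /bregman gradient_separable_ext /inner /separable_ext -!sumrB.
by apply: eq_bigr => j _; rewrite !mxE.
Qed.

(** Both sides share every term except the cross term [- u 0 j * derive1 f (v 0 j)], whose sum
    Cauchy-Schwarz bounds by the square root. *)
Lemma bregman_le_sub_UB (R : realType) (f : R -> R) (m : nat) (u v : 'rV[R]_m) :
  bregman f u v <= sub_UB f u v.
Proof.
rewrite bregmanE /sub_UB.
rewrite (_ : \sum_j _ = \sum_j f (u 0 j) - \sum_j f (v 0 j)
  + \sum_j v 0 j * derive1 f (v 0 j) + \sum_j - u 0 j * derive1 f (v 0 j)).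
  rewrite lerD2l (le_trans (sum_mul_le_sqrt _ _))//.
  by under eq_bigr do rewrite sqrrN.
by rewrite -sumrB -!big_split /=; apply: eq_bigr => j _; ring.
Qed.

Lemma leq_mul_ceil_div (d M : nat) : (0 < M)%N -> (d <= ceil_div d M * M)%N.
Proof.
move=> M0; have := ltn_ceil (d + M.-1)%N M0.
rewrite -/(ceil_div d M) mulSn; lia.
Qed.

(** By induction on [k], the first [k] blocks cover exactly the indices below [minn (c * k) d]; the
    minimum accounts for short and empty blocks. Letting [F] live on [nat] avoids casts between
    ordinals. *)
Lemma sum_blocks (V : nmodType) (d M : nat) (F : nat -> V) : (0 < M)%N ->
  \sum_(i < M) \sum_(j < block_size d M i) F (ceil_div d M * i + j)%N =
  \sum_(j < d) F j.
Proof.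
move=> M0; set c := ceil_div d M.
suff H k : \sum_(i < k) \sum_(j < block_size d M i) F (c * i + j)%N =
    \sum_(j < minn (c * k) d) F j.
  by rewrite H (minn_idPr _)// leq_mul_ceil_div.
elim: k => [|k IHk]; first by rewrite muln0 min0n !big_ord0.
rewrite big_ord_recr /= IHk.
have -> : minn (c * k.+1) d = (minn (c * k) d + block_size d M k)%N.
  rewrite /block_size -/c mulnS; lia.
rewrite big_split_ord /=; congr (_ + _); apply: eq_bigr => j _.
(* An index [j] in block [k] forces [c * k < d], so the minimum is [c * k]. *)
congr (F (_ + _)%N); have := ltn_ord j; rewrite {2}/block_size -/c; lia.
Qed.

Lemma bregman_sum_subvec (R : realType) (f : R -> R) (d M : nat)
    (u v : 'rV[R]_d) : (0 < M)%N ->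
  bregman f u v = \sum_(i < M) bregman f (subvec u i) (subvec v i).
Proof.
move=> M0; rewrite bregmanE.
(* The summand is extended to [nat]; the default 0 is never reached, since every index that occurs
   is below [d]. *)
pose F j := if insub j is Some j' then
  f (u 0 j') - f (v 0 j') - derive1 f (v 0 j') * (u 0 j' - v 0 j') else 0.
transitivity (\sum_(j < d) F j).
  by apply: eq_bigr => j _; rewrite /F valK.
rewrite -(sum_blocks _ _ M0); apply: eq_bigr => i _; rewrite bregmanE.
apply: eq_bigr => j _; rewrite /F !mxE.
by rewrite (insubT (fun a => (a < d)%N) (block_index_lt j)).
Qed.

(** The first [k] entries of the sorted sequence are at most its entry [k.-1], which is [a t];
    sorting preserves the count. *)
Lemma card_le_kth_smallest (R : realType) (n : nat) (a : 'I_n -> R) (k : nat)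
    (t : 'I_n) : (0 < k <= n)%N -> is_kth_smallest a k t ->
  (k <= #|[set l | (a l <= a t)%R]%SET|)%N.
Proof.
move=> /andP[k0 kn] at_kth; set s := sort <=%R (codom a).
have size_s : size s = n by rewrite size_sort size_codom card_ord.
have -> : #|[set l | (a l <= a t)%R]%SET| = count (<= a t) s.
  by rewrite count_sort /codom /image_mem count_map cardsE cardE size_filter
    enumT.
rewrite -(cat_take_drop k s) count_cat.
suff : all (<= a t) (take k s).
  by rewrite all_count => /eqP ->; rewrite size_takel ?size_s// leq_addr.
apply/(all_nthP 0) => i; rewrite size_takel ?size_s// => ik.
rewrite nth_take// at_kth; apply: le_sorted_leq_nth.
- exact: sort_le_sorted.
- by rewrite inE size_s; lia.
- by rewrite inE size_s; lia.
- lia.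
Qed.

(** Pigeonhole: if some [z] in [N] were farther than [r], the at least [k] distinct points indexed
    by [A] would not fit into [N] without [z], so one of them would lie outside [N] and yet be
    nearer than [z]. *)
Lemma knn_bregman_le (R : realType) (f : R -> R) (d n : nat)
    (x : 'I_n -> 'rV[R]_d) (y : 'rV[R]_d) (k : nat) (N : {fset 'rV[R]_d})
    (A : {set 'I_n}) (r : R) : injective x -> is_knn f (range x) y k N ->
  (k <= #|A|)%N -> (forall l, l \in A -> bregman f (x l) y <= r) ->
  forall z, z \in N -> bregman f z y <= r.
Proof.
move=> x_inj [_ N_card N_near] kA Ar z zN; rewrite leNgt; apply/negP => rz.
have [l lA xlN] : exists2 l, l \in A & x l \notin N.
  apply/exists_inP; rewrite -negb_forall_in; apply/negP => /forall_inP AN.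
  have : ([fset x l | l in A] `<=` N `\ z)%fset.
    apply/fsubsetP => _ /imfsetP[l /= lA ->]; rewrite !inE AN// andbT.
    (* No such point equals [z], because its distance is at most [r]. *)
    by apply: contraTneq rz => <-; rewrite -leNgt Ar.
  move=> /fsubset_leq_card; rewrite card_imfset//= -cardE.
  move=> /(leq_trans kA); rewrite -N_card (cardfsD1 z N) zN add1n.
  by rewrite ltnn.
have := N_near z (x l) zN; rewrite leNgt (le_lt_trans (Ar _ lA) rz).
by move=> H; suff: false by []; apply: H; split; [exists l|exact/negP].
Qed.

Theorem theorem3 (R : realType) (I : set R) (f : R -> R)
    (I_itv : is_interval I) (I_open : open I)
    (f_diff : forall a, I a -> derivable f a 1)
    (f_conv : @convex_function R R^o I f)
    (d M : nat) (M_gt0 : (0 < M)%N) (M_le_d : (M <= d)%N)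
    (n : nat) (x : 'I_n -> 'rV[R]_d) (x_inj : injective x)
    (x_in : forall l, vec_in I (x l))
    (y : 'rV[R]_d) (y_in : vec_in I y)
    (k : nat) (k_gt0 : (0 < k)%N) (k_le_n : (k <= n)%N)
    (t : 'I_n) (t_kth : is_kth_smallest (fun l => UB f M (x l) y) k t)
    (N : {fset 'rV[R]_d}) (N_knn : is_knn f (range x) y k N) :
  [set` N] `<=`
    \bigcup_(i in [set: 'I_M])
      candidates f (range x) y
        (fun i' => sub_UB f (subvec (x t) i') (subvec y i')) i.
Proof.
have bregman_le_UB u : bregman f u y <= UB f M u y.
  rewrite (bregman_sum_subvec _ _ _ M_gt0).
  by apply: ler_sum => i _; exact: bregman_le_sub_UB.
have kA := card_le_kth_smallest (introT andP (conj k_gt0 k_le_n)) t_kth.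
move=> z zN; have Nx : range x z by case: N_knn => + _ _; exact.
have : bregman f z y <= UB f M (x t) y.
  (* Here [A] is the set of indices [l] with [UB f M (x l) y <= UB f M (x t) y]. *)
  apply: (knn_bregman_le x_inj N_knn kA) => // l; rewrite inE.
  exact: le_trans.
rewrite (bregman_sum_subvec _ _ _ M_gt0) leNgt => /negP.
(* If [z] missed every candidate set, each block distance would exceed its radius; as there is at
   least one block, the sums would compare strictly. *)
apply: contra_notP => no_i; apply: ltr_sum.
  by apply/hasP; exists (Ordinal M_gt0); rewrite ?mem_index_enum.
move=> i _; rewrite ltNge; apply/negP => le_i.
by apply: no_i; exists i.
Qed.
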